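(* Let $(p_1,p_2,\dots,p_l)$ and $(q_1,q_2,\dots,q_l)$ be $l$-tuples of pairwise relatively prime integers with $1<p_1<\dots<p_l$ and $1<q_1<\dots<q_l$. Suppose $(p_1,p_2,\dots,p_l)\ge(q_1,q_2,\dots,q_l)$, i.e. $p_i\ge q_i$ for all $i$. Then $\kappa(p_1,p_2,\dots,p_l)\ge\kappa(q_1,q_2,\dots,q_l)$.
   Context: For pairwise relatively prime integers $1<p_1<\dots<p_l$, let $(e_0,p_1',\dots,p_l')$ be the unique integers with $1\le p_i'\le p_i-1$ and $e_0p_1\cdots p_l+\sum_{i=1}^l p_i'\prod_{j\ne i}p_j=-1$. Define $$\Delta(n)=1+|e_0|n-\sum_{i=1}^l\left\lceil\frac{np_i'}{p_i}\right\rceil\quad(n\in\mathbb{Z}_{\ge0}),\qquad \kappa(p_1,\dots,p_l)=\left|\sum_{n=0}^\infty\min\{0,\Delta(n)\}\right| .$$ *)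

(* Defs.v *)
From mathcomp Require Import all_boot all_order all_algebra.
From mathcomp Require Import archimedean boolp classical_sets cardinality fsbigop.
From mathcomp Require Import zify ring lra.

Set Implicit Arguments.
Unset Strict Implicit.
Unset Printing Implicit Defensive.

Import Order.TTheory GRing.Theory Num.Theory.
Local Open Scope ring_scope.

(* [path ltn 1 p] says 1 < p_1 < ... < p_l. *)
Definition admissible (l : nat) (p : l.-tuple nat) : Prop :=
  path ltn 1%N p /\ pairwise coprime p.

Definition seifert_invariants (l : nat) (p : l.-tuple nat)
    (x : int * l.-tuple nat) : Prop :=
  let: (e0, p') := x in
  (forall i, 1 <= tnth p' i <= tnth p i - 1)%N /\
  e0 * (\prod_i tnth p i)%N%:Z
    + \sum_i (tnth p' i)%:Z * (\prod_(j | j != i) tnth p j)%N%:Z = -1.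

(* For admissible [p] there is exactly one such pair, see
   [seifert_invariants_exists] and [seifert_invariants_unique];
   the default value [(0, p)] is then irrelevant. *)
Definition seifert (l : nat) (p : l.-tuple nat) : int * l.-tuple nat :=
  xget (0, p) (seifert_invariants p).

Definition Delta (l : nat) (p : l.-tuple nat) (n : nat) : int :=
  let: (e0, p') := seifert p in
  1 + `|e0| * n%:Z
    - \sum_i Num.ceil ((n * tnth p' i)%:R / (tnth p i)%:R : rat).

(* The series has finitely many nonzero terms when [p] is admissible, see
   [finite_support_Delta]; it is written as a finitely supported sum. *)
Definition kappa (l : nat) (p : l.-tuple nat) : nat :=
  `|(\sum_(n \in [set: nat]) Num.min 0 (Delta p n))%R|%N.

Lemma admissible_gt1 l (p : l.-tuple nat) i : admissible p -> (1 < tnth p i)%N.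
Proof.
case=> /(order_path_min ltn_trans) /allP h _.
exact: (h _ (mem_tnth i p)).
Qed.

Lemma admissible_coprime l (p : l.-tuple nat) i j :
  admissible p -> i != j -> coprime (tnth p i) (tnth p j).
Proof.
case=> _ /(pairwiseP 0%N) h.
have lt (a b : 'I_l) : (a < b)%N -> coprime (tnth p a) (tnth p b).
  move=> ab; rewrite !(tnth_nth 0%N); apply: h => //;
  by rewrite inE size_tuple.
rewrite neq_ltn => /orP[/lt //|/lt]; by rewrite coprime_sym.
Qed.

Lemma admissible_coprime_prod l (p : l.-tuple nat) i :
  admissible p -> coprime (\prod_(j | j != i) tnth p j) (tnth p i).
Proof.
move=> hp; elim/big_ind: _ => [|x y hx hy|j ji]; first exact: coprime1n.
  by rewrite coprimeMl hx.
exact: admissible_coprime.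
Qed.

Lemma dvd_prod_coprime l (p : l.-tuple nat) (N : nat) :
  admissible p -> (forall i, tnth p i %| N)%N -> (\prod_i tnth p i %| N)%N.
Proof.
move=> hp hN.
suff h (s : seq 'I_l) : uniq s -> (\prod_(i <- s) tnth p i %| N)%N.
  by apply: h; exact: index_enum_uniq.
elim: s => [|i s IH] /=; first by rewrite big_nil dvd1n.
case/andP=> si us; rewrite big_cons Gauss_dvd ?hN ?IH //.
rewrite big_seq; elim/big_ind: _ => [|x y hx hy|j js]; first exact: coprimen1.
  by rewrite coprimeMr hx.
by apply: admissible_coprime => //; apply: contraNneq si => ->.
Qed.

Lemma seifert_invariants_exists l (p : l.-tuple nat) :
  admissible p -> exists x, seifert_invariants p x.
Proof.
move=> hp; pose P i := (\prod_(j | j != i) tnth p j)%N.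
have h i : exists a : nat,
    (1 <= a <= tnth p i - 1)%N && (tnth p i %| a * P i + 1)%N.
  have pi1 := admissible_gt1 i hp.
  have cop : coprime (P i) (tnth p i) by exact: admissible_coprime_prod.
  have Pi0 : (0 < P i)%N.
    by apply: prodn_gt0 => j; exact: ltnW (admissible_gt1 j hp).
  case: (egcdnP (tnth p i) Pi0) => u v; rewrite (eqP cop) => huv _.
  pose a := (u * (tnth p i).-1 %% tnth p i)%N.
  have dvd : (tnth p i %| a * P i + 1)%N.
    rewrite /dvdn /a -modnDml modnMml modnDml.
    have -> : (u * (tnth p i).-1 * P i + 1 =
              (v * (tnth p i).-1 + 1) * tnth p i)%N.
      have -> : (u * (tnth p i).-1 * P i = (tnth p i).-1 * (u * P i))%N by ring.
      rewrite huv -[in X in (_ = _ * X)%N](prednK (ltnW pi1)).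
      rewrite -[X in (v * X + 1)%N](prednK (ltnW pi1)); ring.
    by rewrite modnMl.
  exists a; rewrite dvd andbT.
  have : (a < tnth p i)%N by rewrite ltn_mod ltnW.
  have a0 : a != 0%N.
    by apply: contraTneq dvd => ->; rewrite mul0n dvdn1; lia.
  lia.
have [f hf] := choice h.
have : (\prod_i tnth p i %| \sum_i f i * P i + 1)%N.
  apply: dvd_prod_coprime => // i.
  rewrite (bigD1 i) //= addnAC dvdn_addr; last by case/andP: (hf i).
  apply: dvdn_sum => j ji; rewrite dvdn_mull // /P.
  by rewrite (bigD1 i) ?dvdn_mulr // eq_sym.
case/dvdnP=> k hk.
exists (- k%:Z, [tuple f i | i < l]); split=> [i|].
  by rewrite tnth_mktuple; case/andP: (hf i).
have -> : \sum_i (tnth [tuple f i | i < l] i)%:Z * (\prod_(j | j != i) tnth p j)%N%:Z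
   = (\sum_i f i * P i)%N%:Z.
  rewrite -natz natr_sum; apply: eq_bigr => i _.
  by rewrite tnth_mktuple natz PoszM.
lia.
Qed.

Lemma seifert_invariants_unique l (p : l.-tuple nat) x y :
  admissible p -> seifert_invariants p x -> seifert_invariants p y -> x = y.
Proof.
move=> hp; pose P i := (\prod_(j | j != i) tnth p j)%N.
case: x y => [e a] [f b] [ha ea] [hb eb].
have P0 : (0 < \prod_i tnth p i)%N.
  by apply: prodn_gt0 => j; exact: ltnW (admissible_gt1 j hp).
have ab : a = b.
  apply: eq_from_tnth => i.
  have hd c g : g * (\prod_i tnth p i)%N%:Z
      + \sum_i (tnth c i)%:Z * (P i)%:Z = -1 ->
      exists z : int, (tnth c i)%:Z * (P i)%:Z + 1 = z * (tnth p i)%:Z.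
    rewrite (bigD1 i) //= [in X in _ + X = _](bigD1 i) //=.
    have : ((tnth p i)%:Z %| \sum_(j < l | j != i) (tnth c j)%:Z * (P j)%:Z)%Z.
      apply: rpred_sum => j ji; rewrite dvdz_mull // /P.
      by rewrite (bigD1 i) ?PoszM ?dvdz_mulr // eq_sym.
    case/dvdzP=> z ->; rewrite PoszM => hz.
    exists (- g * (P i)%:Z - z); rewrite -/(P i) in hz *.
    rewrite -[1]opprK -hz; ring.
  have [z hz] := hd _ _ ea; have [w hw] := hd _ _ eb.
  have : ((tnth p i)%:Z %| ((tnth a i)%:Z - (tnth b i)%:Z) * (P i)%:Z)%Z.
    apply/dvdzP; exists (z - w); rewrite mulrBl [RHS]mulrBl -hz -hw; ring.
  rewrite Gauss_dvdzl; last first.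
    by rewrite coprimezE /= coprime_sym; exact: admissible_coprime_prod.
  case/dvdzP=> k hk; move: (ha i) (hb i) (admissible_gt1 i hp) => ? ? ?.
  have : k = 0 by nia.
  by move=> k0; move: hk; rewrite k0 mul0r; lia.
congr (_, _) => //; subst b.
have : e * (\prod_i tnth p i)%N%:Z = f * (\prod_i tnth p i)%N%:Z.
  by apply: (addIr (\sum_i (tnth a i)%:Z * (P i)%:Z)); rewrite ea eb.
by apply: mulIf; lia.
Qed.

Lemma seifertP l (p : l.-tuple nat) :
  admissible p -> seifert_invariants p (seifert p).
Proof. by move/seifert_invariants_exists; exact: xgetPex. Qed.

Lemma finite_support_Delta l (p : l.-tuple nat) :
  admissible p -> finite_set [set n | Num.min 0 (Delta p n) != 0].
Proof.
move=> hp; set Q := (\prod_i tnth p i)%N.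
have Q0 : (0 < Q)%N.
  by apply: prodn_gt0 => j; exact: ltnW (admissible_gt1 j hp).
apply: (@sub_finite_set _ _ `I_(l * Q)%N); last exact: finite_II.
move=> n /=; apply: contraNltn => hn; apply/eqP/min_idPl.
rewrite /Delta; have := seifertP hp; case: (seifert p) => e a [ha ea].
have e0 : e <= 0.
  have : 0 <= \sum_i (tnth a i)%:Z * (\prod_(j | j != i) tnth p j)%N%:Z.
    by apply: sumr_ge0 => i _; rewrite -PoszM.
  move: ea; rewrite -/Q; set s := \sum_i _; nia.
pose r : rat := \sum_i (tnth a i)%:R / (tnth p i)%:R.
have hr : `|e|%:~R = r + Q%:R^-1.
  have hQ : Q%:R != 0 :> rat by rewrite pnatr_eq0 -lt0n.
  apply: (mulIf hQ); rewrite mulrDl mulVf // /r mulr_suml.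
  have -> : \sum_i (tnth a i)%:R / (tnth p i)%:R * Q%:R =
     (\sum_i (tnth a i)%:Z * (\prod_(j | j != i) tnth p j)%N%:Z)%:~R :> rat.
    rewrite rmorph_sum /=; apply: eq_bigr => i _.
    rewrite /Q (bigD1 i) //= natrM rmorphM /= !mulrA mulfVK //.
    by rewrite pnatr_eq0 -lt0n; exact: ltnW (admissible_gt1 i hp).
  rewrite ler0_norm // -[Q%:R]/((Q%:Z)%:~R) -[1]/(1%:~R) -intrM -intrD.
  by congr (_%:~R); move: ea; rewrite -/Q => ea; lia.
have hs : (\sum_i Num.ceil ((n * tnth a i)%:R / (tnth p i)%:R : rat))%:~R
    <= n%:R * r + l%:R :> rat.
  rewrite rmorph_sum /= mulr_sumr.
  have -> : l%:R = \sum_(i < l) 1 :> rat by rewrite sumr_const card_ord.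
  rewrite -big_split /=; apply: ler_sum => i _.
  rewrite natrM mulrA.
  by have := ceil_itv (n%:R * (tnth a i)%:R / (tnth p i)%:R : rat); lra.
rewrite -(ler_int rat) rmorphB rmorphD rmorphM /= hr.
have : l%:R <= n%:R / Q%:R :> rat.
  by rewrite ler_pdivlMr ?ltr0n // -natrM ler_nat.
move: hs; set s := (\sum_i _)%:~R; rewrite -[n%:~R]/(n%:R : rat) => hs hl.
by rewrite mulrDl [Q%:R^-1 * _]mulrC; lra.
Qed.

(* Main.v *)
Require Import Defs.
From mathcomp Require Import all_boot all_order all_algebra.
From mathcomp Require Import archimedean boolp classical_sets.
From mathcomp Require Import cardinality fsbigop zify ring.

Set Implicit Arguments.
Unset Strict Implicit.
Unset Printing Implicit Defensive.

Import Order.TTheory GRing.Theory Num.Theory.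
Local Open Scope ring_scope.

(** Put P = p_1 ... p_l. By the Chinese remainder theorem every integer n is
    uniquely n = c P + sum_i a_i P / p_i with 0 <= a_i < p_i, and the congruence
    p'_i P / p_i = -1 (mod p_i) gives Delta(n) = 1 + c. Replacing the digits a_i
    by a_i + p_i - q_i, with the same c, turns an expansion for q into one for p;
    it stays nonnegative because (a_i + p_i - q_i) / p_i >= a_i / q_i. So the
    negative terms of the series for q inject, with the same values, into the
    terms of the series for p. *)

Definition expansion l (p : l.-tuple nat) (c : int) (a : 'I_l -> int) : int :=
  c * (\prod_i tnth p i)%N%:Z
    + \sum_i a i * (\prod_(j | j != i) tnth p j)%N%:Z.

Definition digits l (p : l.-tuple nat) (a : 'I_l -> int) : Prop :=
  forall i, 0 <= a i < (tnth p i)%:Z.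

Lemma prod_tnth_gt0 l (p : l.-tuple nat) :
  admissible p -> (0 < \prod_i tnth p i)%N.
Proof. by move=> hp; apply: prodn_gt0 => j; exact: ltnW (admissible_gt1 j hp). Qed.

Lemma prod_tnthD1 l (p : l.-tuple nat) i :
  (\prod_i tnth p i)%N%:Z = (tnth p i)%:Z * (\prod_(j | j != i) tnth p j)%N%:Z.
Proof. by rewrite (bigD1 i) //= PoszM. Qed.

(** Every term other than the [i]-th contains the factor [p_i]. *)
Lemma expansion_mod l (p : l.-tuple nat) c a i :
  (expansion p c a = a i * (\prod_(j | j != i) tnth p j)%N%:Z %[mod tnth p i])%Z.
Proof.
apply/eqP; rewrite eqz_mod_dvd /expansion [\sum_(_ < _) _](bigD1 i) //=.
rewrite addrCA [X in X - _]addrC addrK (prod_tnthD1 p i) rpredD //; first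
  by rewrite dvdz_mull ?dvdz_mulr.
by apply: rpred_sum => j ji; rewrite (bigD1 i) 1?eq_sym //= PoszM dvdz_mull ?dvdz_mulr.
Qed.

(** Modulo [p_i] the cofactor P / p_i is invertible, so the residue fixes the digit [a i]; equal
    digits then cancel and leave c P = d P. *)
Lemma expansion_inj l (p : l.-tuple nat) c d a b :
  admissible p -> digits p a -> digits p b ->
  expansion p c a = expansion p d b -> c = d /\ a =1 b.
Proof.
move=> hp ha hb eab.
have ab : a =1 b.
  move=> i; have := expansion_mod p c a i; rewrite eab expansion_mod => /eqP.
  rewrite eqz_mod_dvd -mulrBl Gauss_dvdzl; last first.
    by rewrite coprimezE /= coprime_sym; exact: admissible_coprime_prod.
  case/dvdzP=> k hk; have := ha i; have := hb i; have := admissible_gt1 i hp.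
  (* Both digits lie in [0, p_i), so their difference, a multiple of [p_i], is zero. *)
  move=> ? ? ?; have k0 : k = 0 by nia.
  by move: hk; rewrite k0 mul0r; lia.
split=> //; move: eab; rewrite (funext ab) => /addIr/mulIf.
by apply; have := prod_tnth_gt0 hp; lia.
Qed.

(** The digits are the rounding errors k_i p_i - n p'_i of the ceilings k_i. In the expansion the
    k_i cancel, and the equation defining [e] leaves n. *)
Lemma expansion_Delta l (p : l.-tuple nat) (n : nat) : admissible p ->
  exists2 a, digits p a & expansion p (Delta p n - 1) a = n%:Z.
Proof.
move=> hp; have := seifertP hp; rewrite /Delta.
case: (seifert p) => e p' [hp' hsum].
pose k i : int := Num.ceil ((n * tnth p' i)%:R / (tnth p i)%:R : rat).
exists (fun i => k i * (tnth p i)%:Z - (n * tnth p' i)%N%:Z) => [i|].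
  have p0 : 0 < (tnth p i)%:R :> rat by rewrite ltr0n ltnW ?(admissible_gt1 i hp).
  have := ceil_itv ((n * tnth p' i)%:R / (tnth p i)%:R : rat); rewrite -/(k i).
  rewrite ltr_pdivlMr // ler_pdivrMr //.
  rewrite -[(n * _)%:R]/((n * tnth p' i)%N%:~R) -[(tnth p i)%:R]/((tnth p i)%:~R).
  rewrite -!intrM ltr_int ler_int.
  lia.
(* The sign turns |e| into -e, as the cancellation requires. *)
have e0 : e <= 0.
  have : 0 <= \sum_i (tnth p' i)%:Z * (\prod_(j | j != i) tnth p j)%N%:Z.
    by apply: sumr_ge0 => i _; rewrite -PoszM.
  by have := prod_tnth_gt0 hp; move: hsum; set s := \sum_i _; nia.
rewrite /expansion -/k.
have -> : \sum_i (k i * (tnth p i)%:Z - (n * tnth p' i)%N%:Z)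
      * (\prod_(j | j != i) tnth p j)%N%:Z
    = (\sum_i k i) * (\prod_i tnth p i)%N%:Z
      - n%:Z * \sum_i (tnth p' i)%:Z * (\prod_(j | j != i) tnth p j)%N%:Z.
  rewrite mulr_suml mulr_sumr -sumrB; apply: eq_bigr => i _.
  by rewrite (prod_tnthD1 p i) PoszM; ring.
rewrite (ler0_norm e0); move: hsum.
set s := \sum_i (tnth p' i)%:Z * _; set P := (\prod_i _)%N%:Z => hsum.
have -> : s = -1 - e * P by rewrite -hsum; ring.
by ring.
Qed.

Lemma Delta_expansion l (p : l.-tuple nat) (n : nat) c a :
  admissible p -> digits p a -> expansion p c a = n%:Z -> Delta p n = 1 + c.
Proof.
move=> hp ha hn; have [b hb hbn] := expansion_Delta n hp.
have [-> _] := expansion_inj hp ha hb (etrans hn (esym hbn)); lia.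
Qed.

(** The shift preserves the gap q_i - a_i between a digit and its modulus. *)
Definition shift_digits l (p q : l.-tuple nat) (a : 'I_l -> int) : 'I_l -> int :=
  fun i => a i + (tnth p i)%:Z - (tnth q i)%:Z.

(** After division by P the expansion is c + sum_i a_i / p_i, and each fraction grows under the
    shift. *)
Lemma expansion_shift_ge0 l (p q : l.-tuple nat) c a :
  admissible p -> admissible q -> (forall i, tnth q i <= tnth p i)%N ->
  digits q a -> 0 <= expansion q c a -> 0 <= expansion p c (shift_digits p q a).
Proof.
move=> hp hq qp ha; rewrite /expansion /shift_digits.
have := prod_tnth_gt0 hp; have := prod_tnth_gt0 hq.
(* The comparison of the sums of fractions, multiplied by P Q to stay in the integers. *)
have : (\prod_i tnth p i)%N%:Z * \sum_i a i * (\prod_(j | j != i) tnth q j)%N%:Z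
   <= (\prod_i tnth q i)%N%:Z *
      \sum_i (a i + (tnth p i)%:Z - (tnth q i)%:Z)
        * (\prod_(j | j != i) tnth p j)%N%:Z.
  rewrite !mulr_sumr; apply: ler_sum => i _.
  rewrite (prod_tnthD1 p i) (prod_tnthD1 q i).
  set P := (\prod_(j | _) tnth p j)%N; set Q := (\prod_(j | _) tnth q j)%N.
  have -> : (tnth p i)%:Z * P%:Z * (a i * Q%:Z)
    = (tnth p i)%:Z * a i * (P * Q)%N%:Z by rewrite PoszM; ring.
  have -> : (tnth q i)%:Z * Q%:Z * ((a i + (tnth p i)%:Z - (tnth q i)%:Z) * P%:Z)
    = (tnth q i)%:Z * (a i + (tnth p i)%:Z - (tnth q i)%:Z) * (P * Q)%N%:Z.
    by rewrite PoszM; ring.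
  apply: ler_wpM2r => //.
  (* This is (p_i - q_i)(q_i - a_i) >= 0. *)
  have := ha i; have := qp i; nia.
set SP := \sum_i (_ + _ - _) * _; set SQ := \sum_i _ * _.
set P := (\prod_i _)%N; set Q := (\prod_i _)%N => hS Q0 P0 h.
have : 0 <= P%:Z * (c * Q%:Z + SQ) by apply: mulr_ge0.
by move=> h'; rewrite -(pmulr_rge0 (x := Q%:Z)) //; lia.
Qed.

Lemma Delta_transfer l (p q : l.-tuple nat) :
  admissible p -> admissible q -> (forall i, tnth q i <= tnth p i)%N ->
  exists2 f : nat -> nat, injective f & forall n, Delta p (f n) = Delta q n.
Proof.
move=> hp hq qp.
have h n : exists a, digits q a /\ expansion q (Delta q n - 1) a = n%:Z.
  by have [a ? ?] := expansion_Delta n hq; exists a.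
have [a ha] := choice h.
have hb n : digits p (shift_digits p q (a n)).
  by move=> i; have := (ha n).1 i; have := qp i; rewrite /shift_digits; lia.
(* The absolute value only casts to [nat]: the shifted expansion is nonnegative. *)
pose f n := `|expansion p (Delta q n - 1) (shift_digits p q (a n))|%N.
have fE n : expansion p (Delta q n - 1) (shift_digits p q (a n)) = (f n)%:Z.
  rewrite /f gez0_abs // expansion_shift_ge0 //; first exact: (ha n).1.
  by rewrite (ha n).2.
exists f => [m n fmn | n]; last by rewrite (Delta_expansion hp (hb n) (fE n)); lia.
have [hD hs] := expansion_inj hp (hb m) (hb n)
  (etrans (fE m) (etrans (congr1 Posz fmn) (esym (fE n)))).
have am : a m = a n.
  by apply/funext => i; have := hs i; rewrite /shift_digits; lia.
by apply/eqP; rewrite -eqz_nat -(ha m).2 -(ha n).2 hD am.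
Qed.

(** The sum of [F] is the part of the sum of [G] over the image of [f]; the remaining terms are
    nonpositive. *)
Lemma le_fsum_inj (I J : choiceType) (F : I -> int) (G : J -> int) (f : I -> J) :
  finite_set [set j | G j != 0] -> (forall j, G j <= 0) ->
  injective f -> (forall i, G (f i) = F i) ->
  \sum_(j \in [set: J]) G j <= \sum_(i \in [set: I]) F i.
Proof.
move=> fG G0 finj GF.
have -> : \sum_(i \in [set: I]) F i = \sum_(j \in [set f i | i in [set: I]]) G j.
  rewrite fsbig_image; last by move=> x y _ _; exact: finj.
  by apply: eq_fsbigr => i _; rewrite GF.
rewrite fsbig_supp setTI [leRHS]fsbig_supp.
have -> : (G @^-1` [set~ 0] = [set j | G j != 0])%classic.
  by apply/seteqP; split=> j /= /eqP.
(* Finite support permits this split into the image of [f] and its complement. *)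
rewrite (fsbigID (f @` [set: I])%classic) //= setIC.
by rewrite gerDl; exact: fsumr_le0.
Qed.

Theorem proposition4p14 (l : nat) (p q : l.-tuple nat) :
  admissible p -> admissible q ->
  (forall i : 'I_l, tnth q i <= tnth p i)%N ->
  (kappa q <= kappa p)%N.
Proof.
move=> hp hq qp; have [f finj fD] := Delta_transfer hp hq qp.
have min_le0 r n : Num.min 0 (Delta (l := l) r n) <= 0 by rewrite ge_min lexx.
(* Both series are nonpositive, so absolute values reverse their order. *)
have absz_le (x y : int) : y <= x -> x <= 0 -> (`|x| <= `|y|)%N by lia.
apply: absz_le; last exact: fsumr_le0.
apply: (le_fsum_inj (f := f)) => // [|n]; first exact: finite_support_Delta.
by rewrite fD.
Qed.
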